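(* Let $X$, $Y$ be compact metric spaces and let $\Lambda$ be a topological space. Suppose $\varphi_*\colon\Lambda\to\mathbf{DS}(\mathbb T,X)$ and $\psi_*\colon\Lambda\to\mathbf{DS}(\mathbb T,Y)$ are conjugate parametrized dynamical systems. Then the étale spaces $\varphi_*^{-1}\Pi[\mathsf{Att}]$ and $\psi_*^{-1}\Pi[\mathsf{Att}]$ are homeomorphic.
   Context: Time space: $\mathbb T\in\{\mathbb Z,\mathbb Z^+,\mathbb R,\mathbb R^+\}$ with the usual topology ($\mathbb Z^+,\mathbb R^+$ denote the nonnegative integers/reals). A dynamical system on $X$ is a continuous map $\phi\colon\mathbb T\times X\to X$ with $\phi(0,x)=x$ and $\phi(t,\phi(s,x))=\phi(t+s,x)$; write $\phi_t=\phi(t,\cdot)$. $\mathbf{DS}(\mathbb T,X)$ is the set of all dynamical systems on $X$ with the compact-open topology. Attractors: for $U\subset X$, $\omega_\phi(U)=\bigcap_{t\ge0}\mathrm{cl}\bigcup_{s\ge t}\phi_s(U)$. $U$ is an attracting neighborhood for $\phi$ if $\omega_\phi(U)\subset\mathrm{int}\,U$; the set of these is $\mathsf{ANbhd}(\phi)$. $A$ is an attractor if $A=\omega_\phi(U)$ for some $U\in\mathsf{ANbhd}(\phi)$; $\mathsf{Att}(\phi)$ is the set of attractors. Étale space of attractors: $\Pi[\mathsf{Att}]=\{(\phi,A):\phi\in\mathbf{DS}(\mathbb T,X),\ A\in\mathsf{Att}(\phi)\}$ with the topology having as basis the sets $\{(\phi,\omega_\phi(U)):\phi\in\Omega\}$,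 where $U\subset X$ and $\Omega$ is open in $\mathbf{DS}(\mathbb T,X)$ with $U\in\mathsf{ANbhd}(\phi)$ for all $\phi\in\Omega$; the projection is $\pi(\phi,A)=\phi$ (a local homeomorphism). The same definitions apply to $Y$. Parametrized dynamical system over $\Lambda$ on $X$: a continuous map $\varphi\colon\mathbb T\times X\times\Lambda\to X$ such that $\phi^\lambda:=\varphi(\cdot,\cdot,\lambda)\in\mathbf{DS}(\mathbb T,X)$ for all $\lambda$; it is identified with its (continuous) transpose $\varphi_*\colon\Lambda\to\mathbf{DS}(\mathbb T,X)$, $\lambda\mapsto\phi^\lambda$. Pullback étale space: $\varphi_*^{-1}\Pi[\mathsf{Att}]=\{(\lambda,\phi,A)\in\Lambda\times\Pi[\mathsf{Att}]:\phi=\phi^\lambda\}$ with the subspace topology of the product, projecting to $\Lambda$. Conjugacy: $\varphi_*$ and $\psi_*$ are conjugate if there are a continuous map $h\colon\Lambda\times X\to Y$ and a continuous map $\tau\colon\Lambda\times\mathbb T\times X\to\mathbb T$ such that, with $h^\lambda=h(\lambda,\cdot)$, $\tau^\lambda=\tau(\lambda,\cdot,\cdot)$: (i) for every $\lambda\in\Lambda$, $h^\lambda\colon X\to Y$ is a homeomorphism, $\tau^\lambda(0,x)=0$, $t\mapsto\tau^\lambda(t,x)$ is a strictly increasing bijection of $\mathbb T$ for each $x$, and $h^\lambda(\phi^\lambda(t,x))=\psi^\lambda(\tau^\lambda(t,x),h^\lambda(x))$ for all $t,x$; (ii) the connected components $X_i$ of $X$ and $Y_i$ of $Y$ can be indexed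 so that $h^\lambda(X_i)=Y_i$ for all $i$ and all $\lambda\in\Lambda$ (the indexing being independent of $\lambda$). *)

(* Defs.v *)
From HB Require Import structures.
From mathcomp Require Import all_boot all_order all_algebra.
From mathcomp Require Import all_classical all_reals all_analysis.
Set Implicit Arguments.
Unset Strict Implicit.
Unset Printing Implicit Defensive.
Import Order.TTheory GRing.Theory Num.Theory.
Import numFieldNormedType.Exports.
Local Open Scope classical_set_scope.
Local Open Scope ring_scope.

Section homeomorphisms.
Context {S T : topologicalType}.

Definition homeomorphism (f : S -> T) : Prop :=
  continuous f /\
  exists g : T -> S, [/\ continuous g, cancel f g & cancel g f].

End homeomorphisms.

Definition homeomorphic (S T : topologicalType) : Prop :=
  exists f : S -> T, homeomorphism f.

Inductive time_kind := TimeZ | TimeZplus | TimeR | TimeRplus.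

Section time.
Context {R : realType}.

Definition time_set (k : time_kind) : set R :=
  match k with
  | TimeZ => range (fun n : int => n%:~R)
  | TimeZplus => range (fun n : nat => n%:R)
  | TimeR => setT
  | TimeRplus => [set t | 0 <= t]
  end.

Lemma time_set0 k : time_set k 0.
Proof. by case: k => //=; [exists 0|exists 0%N]. Qed.

Lemma time_setD k s t : time_set k s -> time_set k t -> time_set k (s + t).
Proof.
case: k => //=; last exact: addr_ge0.
- by move=> [m _ <-] [n _ <-]; exists (m + n); rewrite // intrD.
- by move=> [m _ <-] [n _ <-]; exists (m + n)%N; rewrite // natrD.
Qed.

End time.

(* The topology is the subspace topology inherited from R: it is discrete for
   the two integer time spaces. *)
Notation time R k := (set_type (@time_set R k)).

Section time_operations.
Context {R : realType} {k : time_kind}.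

Definition time0 : time R k := SigSub (mem_set (@time_set0 R k)).

Definition time_add (s t : time R k) : time R k :=
  SigSub (mem_set (time_setD (set_valP s) (set_valP t))).

End time_operations.

Section dynamical_systems.
Context (R : realType) (k : time_kind) (X : topologicalType).

Definition is_dynsys (f : time R k * X -> X) : Prop :=
  [/\ continuous f,
      forall x, f (time0, x) = x &
      forall s t x, f (t, f (s, x)) = f (time_add t s, x)].

(* As a [set_type], it carries the subspace topology of the compact-open
   topology. *)
Definition DS : Type :=
  set_type [set f : {compact-open, (time R k * X)%type -> X} | is_dynsys f].

HB.instance Definition _ := Topological.on DS.

Definition flow (phi : DS) (t : time R k) (x : X) : X := \val phi (t, x).

Definition omega (phi : DS) (U : set X) : set X :=
  \bigcap_(t in [set t : time R k | 0 <= \val t])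
    closure (\bigcup_(s in [set s : time R k | \val t <= \val s])
      flow phi s @` U).

Definition attracting_nbhd (phi : DS) (U : set X) : Prop :=
  omega phi U `<=` U°.

Definition attractor (phi : DS) (A : set X) : Prop :=
  exists2 U, attracting_nbhd phi U & A = omega phi U.

Record etale_att := EtaleAtt {
  etale_sys : DS;
  etale_set : set X;
  etale_attP : attractor etale_sys etale_set }.

HB.instance Definition _ := gen_eqMixin etale_att.
HB.instance Definition _ := gen_choiceMixin etale_att.

Definition etale_basic (i : set X * set DS) : set etale_att :=
  [set e | i.2 (etale_sys e) /\ etale_set e = omega (etale_sys e) i.1].

Definition etale_basic_index : set (set X * set DS) :=
  [set i | open i.2 /\ forall phi, i.2 phi -> attracting_nbhd phi i.1].

(* The topology generated by the sets [etale_basic i].  That these form a basis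
   is a theorem for compact metric X (stability of attracting neighborhoods), in
   which case the generated topology is the one having them as a basis; the
   subbase builder is used because it does not ask for that proof. *)
HB.instance Definition _ :=
  @isSubBaseTopological.Build etale_att (set X * set DS)%type
    etale_basic_index etale_basic.

End dynamical_systems.

Section parametrized_systems.
Context (R : realType) (k : time_kind) (L X : topologicalType).

Record param_dynsys := ParamDynsys {
  pds_fun : time R k * X * L -> X;
  pds_continuous : continuous pds_fun;
  pds_dynsys : forall l, is_dynsys (fun p => pds_fun (p, l)) }.

Definition pds_star (phi : param_dynsys) (l : L) : DS R k X :=
  SigSub (mem_set (pds_dynsys phi l)).

Definition etale_pullback (phi : param_dynsys) : Type :=
  set_type [set p : L * etale_att R k X | etale_sys p.2 = pds_star phi p.1].

HB.instance Definition _ phi := Topological.on (etale_pullback phi).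

End parametrized_systems.

Definition indexes_components (X : topologicalType) (I : Type)
    (C : I -> set X) : Prop :=
  injective C /\ range C = range (connected_component [set: X]).

Definition conjugate (R : realType) (k : time_kind) (L X Y : topologicalType)
    (phi : param_dynsys R k L X) (psi : param_dynsys R k L Y) : Prop :=
  exists (h : L * X -> Y) (tau : L * time R k * X -> time R k),
    [/\ continuous h,
        continuous tau,
        forall l,
          [/\ homeomorphism (fun x => h (l, x)),
              forall x, tau (l, time0, x) = time0,
              forall x s t, \val s < \val t ->
                \val (tau (l, s, x)) < \val (tau (l, t, x)),
              forall x, bijective (fun t => tau (l, t, x)) &
              forall t x, h (l, flow (pds_star phi l) t x) =
                flow (pds_star psi l) (tau (l, t, x)) (h (l, x))] &
        exists (I : Type) (XC : I -> set X) (YC : I -> set Y),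
          [/\ indexes_components XC,
              indexes_components YC &
              forall i l, (fun x => h (l, x)) @` XC i = YC i]].

(* Main.v *)
Require Import Defs.
From mathcomp Require Import finmap.
From mathcomp Require Import all_boot all_order all_algebra.
From mathcomp Require Import all_classical all_reals all_analysis.
Set Implicit Arguments.
Unset Strict Implicit.
Unset Printing Implicit Defensive.
Import Order.TTheory GRing.Theory Num.Theory.
Import numFieldNormedType.Exports.
Local Open Scope classical_set_scope.
Local Open Scope ring_scope.

(** A conjugacy sends the point (l, phi_l, A) of one pullback to
    (l, psi_l, h_l(A)).  Three facts make this a homeomorphism.

    Omega-limit sets are carried to omega-limit sets.  A point of omega(U) is a
    limit of points moved for arbitrarily long times.  Since X is compact, the
    change of time tends to infinity uniformly in the starting point, and at a
    fixed time it is bounded, so long times correspond to long times in both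
    directions and omega(h_l(U)) = h_l(omega(U)) ([omega_image]).  Hence h_l
    carries attracting neighborhoods and attractors to such.  The inverse g of
    h is jointly continuous by compactness of X
    ([fiberwise_inverse_continuous]), so the situation is symmetric and only
    the continuity of the map above has to be shown.

    Attracting neighborhoods are stable.  If omega(U) lies in the interior of U
    then, by compactness, all times beyond some n map the closure of U into
    that interior ([attracting_nbhd_absorb]).  Conversely it is enough to know
    this for the times between n and 2n, because later times are reached by
    iteration ([attracting_nbhd_of_absorb]); and over a compact set of times
    it is an open condition in the compact-open topology
    ([attracting_nbhd_stable]).

    Two neighborhoods that swallow each other have the same omega-limit set: if
    some time-t map sends U into V then omega(U) is contained in omega(V)
    ([omega_sub_absorb]).  Let V be attracting for psi at l0 and let U be its
    preimage under h at l0.  At l0 the set h_l(U) is V, and a single time maps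
    the closure of V into the interior of V; by joint continuity and
    compactness the same time still maps h_l(U) into V and V into h_l(U) for l
    near l0.  So h_l(omega(U)) = omega(h_l(U)) = omega(V) for these l
    ([omega_transport_near]), which says that the basic neighborhood defined by
    U is mapped into the one defined by V. *)

(** * Compactness and continuity *)

Section topology.

Lemma continuous_pair (T X Y : topologicalType) (f : T -> X) (g : T -> Y) :
  continuous f -> continuous g -> continuous (fun t => (f t, g t)).
Proof.
by move=> cf cg t; apply: (@cvg_pair _ _ _ (nbhs t)); [exact: cf|exact: cg].
Qed.

Lemma continuous_id (T : topologicalType) : continuous (@id T).
Proof. by move=> t; exact: cvg_id. Qed.

Lemma compact_set_val (X : topologicalType) (A B : set X) :
  compact B -> B `<=` A -> compact ((fun x : A => \val x) @^-1` B).
Proof.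
move=> cB BA F FF FB.
have [x [Bx clx]] : B `&` cluster ((fun x : A => \val x) @ F) !=set0.
  exact: cB.
exists (SigSub (mem_set (BA _ Bx))); split=> //= C D FC.
move=> [W [/= [V oV VW] Wx] WD].
have [y [[z Cz zy] Vy]] : ((fun x : A => \val x) @` C) `&` V !=set0.
  apply: clx; first by apply: (@filterS _ F _ C) => // z Cz; exists z.
  by apply: open_nbhs_nbhs; split=> //; move: Wx; rewrite -VW.
by exists z; split=> //; apply: WD; rewrite -VW /= -zy in Vy *.
Qed.

(** Tube lemma: compactness of K makes uniform the neighborhoods of l0 that
    continuity provides at the points of K. *)
Lemma near_image_sub (L X Y : topologicalType) (f : L * X -> Y) (K : set X)
    (O : set Y) (l0 : L) :
  continuous f -> compact K -> open O -> (forall x, K x -> O (f (l0, x))) ->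
  \forall l \near l0, forall x, K x -> O (f (l, x)).
Proof.
move=> cf /compact_near_coveringP cK oO KO.
apply: (cK L (nbhs l0) (fun l x => O (f (l, x)))) => x Kx.
have /cf [[P Q] /= [nP nQ] PQ] : nbhs (f (l0, x)) O.
  by apply: open_nbhs_nbhs; split=> //; exact: KO.
by exists (Q, P) => //= -[x' l] /= [Qx' Pl]; exact: (PQ (l, x')).
Qed.

Lemma image_closure_sub (X Y : topologicalType) (f : X -> Y) (A : set X) :
  continuous f -> f @` closure A `<=` closure (f @` A).
Proof.
move=> cf _ [x clx <-] B /cf /clx [z [Az Bz]].
by exists (f z); split=> //; exists z.
Qed.

Lemma image_closure (X Y : topologicalType) (f : X -> Y) (g : Y -> X)
    (A : set X) :
  continuous f -> continuous g -> cancel f g -> cancel g f ->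
  f @` closure A = closure (f @` A).
Proof.
move=> cf cg fK gK; apply/seteqP; split=> [|y cly].
  exact: image_closure_sub.
exists (g y); last exact: gK.
move=> B nB.
have /cly [z [[x Ax <-] Bx]] : nbhs y (g @^-1` B) by apply: cg.
by exists x; split=> //; move: Bx; rewrite /= fK.
Qed.

Lemma image_interior (X Y : topologicalType) (f : X -> Y) (g : Y -> X)
    (A : set X) :
  continuous g -> cancel f g -> cancel g f ->
  f @` A° `<=` (f @` A)°.
Proof.
move=> cg fK gK _ [x nA <-]; rewrite /interior /=.
have : nbhs (f x) (g @^-1` A) by apply: cg; rewrite fK.
by apply: filterS => y Ay; exists (g y).
Qed.

(** If g (l0, y0) lies in an open set W, then h (l0, x) differs from y0 for
    all x outside W. Distinct points of Y have disjoint neighborhoods and the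
    complement of W is compact, so h (l, x) differs from y for all such x as
    soon as (l, y) is close to (l0, y0); then g (l, y) lies in W. *)
Lemma fiberwise_inverse_continuous (L X Y : topologicalType)
    (h : L * X -> Y) (g : L * Y -> X) :
  compact [set: X] -> hausdorff_space Y -> continuous h ->
  (forall l, cancel (fun x => h (l, x)) (fun y => g (l, y))) ->
  (forall l, cancel (fun y => g (l, y)) (fun x => h (l, x))) ->
  continuous g.
Proof.
move=> cX hY ch hK gK [l0 y0] B.
rewrite nbhsE => -[W [oW Wg] WB].
have cC : compact (~` W).
  by apply: (subclosed_compact _ cX) => //; exact: open_closedC.
have : \forall p \near (l0, y0), forall x, (~` W) x -> h (p.1, x) != p.2.
  apply: ((compact_near_coveringP _).1 cC (L * Y)%type (nbhs (l0, y0))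
    (fun p x => h (p.1, x) != p.2)) => x nWx.
  have : h (l0, x) != y0.
    by apply/eqP => hxy; apply: nWx; rewrite -(hK l0 x) hxy.
  rewrite eq_sym; move: hY; rewrite open_hausdorff => /[apply].
  move=> [[U V] /= [/set_mem Uy /set_mem Vh] [oU oV UV0]].
  have /ch [[P Q] /= [nP nQ] PQ] : nbhs (h (l0, x)) V by exact: open_nbhs_nbhs.
  exists (Q, (P `*` U)) => /=.
    split=> //; exists (P, U) => //=; split=> //; exact: open_nbhs_nbhs.
  move=> [x' [l y]] /= [Qx' [Pl Uy']]; apply/eqP => hxy.
  have : (U `&` V) y by split=> //; rewrite -hxy; exact: (PQ (l, x')).
  by rewrite (eqP UV0).
apply: filterS => -[l y] /= H; apply: WB; apply: contrapT => nW.
by have /eqP := H _ nW; apply; rewrite gK.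
Qed.

Lemma closed_image_compact (X Y : topologicalType) (f : X -> Y) (K : set X) :
  hausdorff_space Y -> continuous f -> compact K -> closed (f @` K).
Proof.
move=> hY cf cK; apply: compact_closed => //.
by apply: continuous_compact => //; exact: continuous_subspaceT.
Qed.

Lemma compact_closure (X : topologicalType) (A : set X) :
  compact [set: X] -> compact (closure A).
Proof.
by move=> cX; apply: (subclosed_compact _ cX) => //; exact: closed_closure.
Qed.

(** The finite intersection property in the form needed for omega-limit sets,
    which are decreasing intersections of closures. *)
Lemma closed_sub_near_pinfty (R : realType) (T : topologicalType) 
    (K : R -> set T) (O : set T) :
  compact [set: T] -> open O -> (forall r r', r <= r' -> K r' `<=` K r) ->
  (forall r, closed (K r)) -> \bigcap_r K r `<=` O ->
  \forall r \near +oo, K r `<=` O.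
Proof.
move=> /compact_near_coveringP cT oO Kle clK KO.
have : \forall r \near +oo, [set: T] `<=` [set x | K r x -> O x].
  apply: (cT R +oo (fun r x => K r x -> O x)) => x _.
  have [Ox|nOx] := pselect (O x).
    exists (O, setT) => /=; last by move=> [y r] /= [].
    by split; [exact: open_nbhs_nbhs|exact: filterT].
  (* Once x is outside some K r, it stays outside all later ones. *)
  have [r nKr] : exists r, ~ K r x.
    by apply/existsNP => Kx; apply: nOx; apply: KO => r _; exact: Kx.
  exists (~` K r, [set r' | r <= r']) => /=.
    split; last exact/nbhs_pinfty_ge/num_real.
    by apply: open_nbhs_nbhs; split=> //; exact: closed_openC.
  by move=> [y r'] /= [nKy rr'] Ky; case: nKy; exact: (Kle _ _ rr').
by apply: filterS => r KrO x; exact: KrO.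
Qed.

Lemma image_cancel (T S : Type) (f : T -> S) (g : S -> T) (A : set T) :
  cancel f g -> g @` (f @` A) = A.
Proof.
move=> fK; apply/seteqP; split=> [_ [_ [x Ax <-] <-]|x Ax]; first by rewrite fK.
by exists (f x) => //; exists x.
Qed.

Lemma continuous_fiber (L Z T : topologicalType) (f : L * Z -> T) l :
  continuous f -> continuous (fun z => f (l, z)).
Proof.
move=> cf z; apply: (@continuous_comp _ _ _ (fun z => (l, z)) f).
  by apply: continuous_pair; [exact: cst_continuous|exact: continuous_id].
exact: cf.
Qed.

End topology.

(** * Time *)

Section time_theory.
Context {R : realType} {k : time_kind}.
Implicit Types (s t : time R k) (n : nat).

Lemma time_set_nat n : @time_set R k n%:R.
Proof.
by case: k => //=; [exists n%:Z|exists n].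
Qed.

Definition time_nat n : time R k := SigSub (mem_set (time_set_nat n)).

Lemma time_setB (s t : R) :
  time_set k s -> time_set k t -> t <= s -> time_set k (s - t).
Proof.
case: k => //=; last by move=> *; rewrite subr_ge0.
- by move=> [m _ <-] [n _ <-] _; exists (m - n) => //; rewrite intrB.
- move=> [m _ <-] [n _ <-]; rewrite ler_nat => nm.
  by exists (m - n)%N => //; rewrite natrB.
Qed.

Definition time_sub s t (ts : \val t <= \val s) : time R k :=
  SigSub (mem_set (time_setB (set_valP s) (set_valP t) ts)).

Lemma time_subK s t (ts : \val t <= \val s) : time_add (time_sub ts) t = s.
Proof. by apply: val_inj; rewrite /= subrK. Qed.

(** Integer segments are finite; for continuous time one restricts a compact
    interval of the reals. *)
Lemma compact_time_segment n m :
  compact [set t : time R k | n%:R <= \val t <= m%:R].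
Proof.
suff [B [cB BT BE]] : exists B : set R, [/\ compact B, B `<=` time_set k &
    forall t, (B (\val t)) <-> n%:R <= \val t <= m%:R].
  have -> : [set t : time R k | n%:R <= \val t <= m%:R] =
      (fun t : time R k => \val t) @^-1` B.
    by apply/seteqP; split=> t /BE.
  exact: compact_set_val.
pose N : set R := [set (i%:R : R) | i in [set i | (n <= i <= m)%N]].
have cN : compact N.
  apply: finite_compact; apply: finite_image.
  by apply: sub_finite_set (finite_II m.+1) => i /= /andP[].
case: k.
- exists N; split=> //.
    by move=> _ [i _ <-]; exists i%:Z.
  move=> t; split=> [[i + <-]|]; first by rewrite !ler_nat.
  have [j _ <-] := set_valP t.
  case: j => [j|j]; first by rewrite -pmulrn !ler_nat => H; exists j.
  move=> /andP[n0]; have := le_trans (ler0n R n) n0.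
  by rewrite ler0z.
- exists N; split=> //.
    by move=> _ [i _ <-]; exists i.
  move=> t; split=> [[i + <-]|]; first by rewrite !ler_nat.
  by have [j _ <-] := set_valP t; rewrite !ler_nat => H; exists j.
- exists `[n%:R, m%:R]%classic; split=> //; exact: segment_compact.
- exists `[n%:R, m%:R]%classic; split; first exact: segment_compact.
    by move=> t; rewrite /= in_itv /= => /andP[+ _]; exact: le_trans.
  by move=> t; rewrite /= in_itv.
Qed.

Lemma time_nat_ge (r : R) : exists n, r <= n%:R.
Proof.
exists (Num.bound `|r|).
by apply: (le_trans (ler_norm r)); apply/ltW; exact: archi_boundP.
Qed.

End time_theory.

(** * Omega-limit sets and the stability of attracting neighborhoods *)

Section flows.
Context (R : realType) (k : time_kind) (X : topologicalType).
Implicit Types (phi : DS R k X) (U V A : set X) (s t : time R k).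

Lemma DS_dynsys phi : is_dynsys (\val phi).
Proof. exact: set_valP. Qed.

Lemma flow_continuous phi : continuous (fun p => flow phi p.1 p.2).
Proof.
have [cphi _ _] := DS_dynsys phi.
by have -> : (fun p => flow phi p.1 p.2) = \val phi by apply/funext => -[].
Qed.

Lemma flow_continuousr phi t : continuous (flow phi t).
Proof.
move=> x; apply: (@continuous_comp _ _ _ (fun y => (t, y))
  (fun p => flow phi p.1 p.2)).
  by apply: continuous_pair; [exact: cst_continuous|exact: continuous_id].
exact: flow_continuous.
Qed.

Lemma flow_add phi s t x :
  flow phi (time_add t s) x = flow phi t (flow phi s x).
Proof. by have [_ _ phiD] := DS_dynsys phi; rewrite /flow phiD. Qed.

Lemma flow_sub phi s t (ts : \val t <= \val s) x :
  flow phi s x = flow phi (time_sub ts) (flow phi t x).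
Proof. by rewrite -flow_add time_subK. Qed.

(** The bound r is any real number, rather than a time: it may then come from
    a compactness argument on the reals. *)
Definition tail phi U (r : R) : set X :=
  \bigcup_(s in [set s : time R k | r <= \val s]) flow phi s @` U.

Lemma tailS phi U r r' : r <= r' -> tail phi U r' `<=` tail phi U r.
Proof.
by move=> rr' x [s /= r's ?]; exists s => //=; exact: (le_trans rr').
Qed.

Lemma omegaP phi U x : omega phi U x <-> forall r : R, closure (tail phi U r) x.
Proof.
split=> [om r|cl t _]; last exact: cl.
have [n rn] := time_nat_ge r.
by apply: (closureS (tailS rn)); exact: (om (time_nat n) (ler0n _ _)).
Qed.

Lemma omega_sub phi psi U V :
  (forall r : R, exists r' : R, tail phi U r' `<=` tail psi V r) ->
  omega phi U `<=` omega psi V.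
Proof.
move=> UV x /omegaP om; apply/omegaP => r; have [r' /closureS] := UV r.
by apply; exact: om.
Qed.

(** Points of U moved for time s + t are points of V moved for time s. *)
Lemma omega_sub_absorb phi U V t : flow phi t @` U `<=` V ->
  omega phi U `<=` omega phi V.
Proof.
move=> UV; apply: omega_sub => r; exists (Num.max (\val t) (r + \val t)).
move=> y [s /=]; rewrite ge_max => /andP[ts rts] [x Ux <-].
rewrite (flow_sub phi ts); exists (time_sub ts); first by rewrite /= lerBrDr.
by exists (flow phi t x) => //; apply: UV; exists x.
Qed.

(** The tails of U have closures that decrease to the omega-limit set, so by
    compactness one of these closures lies in the interior of U. The
    conclusion is about the closure of U, and not only U, because a condition
    on a compact set is needed to vary the flow. *)
Lemma attracting_nbhd_absorb phi U :
  compact [set: X] -> attracting_nbhd phi U ->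
  exists2 n : nat, (0 < n)%N &
    forall t x, n%:R <= \val t -> closure U x -> U° (flow phi t x).
Proof.
move=> cX aU.
have [] : \forall r \near +oo, closure (tail phi U r) `<=` U°.
  apply: closed_sub_near_pinfty => //; first exact: open_interior.
  - by move=> r r' rr'; apply: closureS; exact: tailS.
  - by move=> r; exact: closed_closure.
  - by move=> x om; apply: aU; apply/omegaP => r; exact: om.
move=> M [_ MU]; have [n Mn] := time_nat_ge M.
exists n.+1 => // t x nt clx; apply: (MU (\val t)).
  by apply: (lt_le_trans _ nt); apply: (le_lt_trans Mn); rewrite ltr_nat.
apply: (@closureS _ (flow phi t @` U)).
  by move=> y Uy; exists t => /=.
by apply: image_closure_sub; [exact: flow_continuousr|exists x].
Qed.

Lemma compact_segment_closure n m U :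
  compact [set: X] ->
  compact ([set t : time R k | n%:R <= \val t <= m%:R] `*` closure U).
Proof.
move=> cX; apply: compact_setX; first exact: compact_time_segment.
exact: compact_closure.
Qed.

(** A time t beyond 2n is n after t - n, and by induction the orbit is in U at
    time t - n: its last stretch, of length n, starts in U. *)
Lemma attracting_nbhd_iterate phi U n :
  (0 < n)%N ->
  (forall t x, n%:R <= \val t <= (n.*2)%:R ->
    closure U x -> U° (flow phi t x)) ->
  forall t x, n%:R <= \val t -> closure U x ->
  exists s y, [/\ n%:R <= \val s <= (n.*2)%:R, closure U y &
    flow phi t x = flow phi s y].
Proof.
move=> n0 absU t x nt; have [m tm] := time_nat_ge (\val t).
have {}tm : \val t <= (n.*2 + m * n)%:R.
  apply: le_trans tm _; rewrite ler_nat; apply: leq_trans (leq_addl _ _).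
  by rewrite leq_pmulr.
elim: m t nt tm x => [|m IH] t nt tm x clx.
  by exists t, x; split=> //; rewrite nt -[n.*2]addn0 -[0%N](mul0n n) tm.
have [t2|t2] := leP (\val t) (n.*2)%:R.
  by exists t, x; split=> //; rewrite nt t2.
have nt' : \val (time_nat n : time R k) <= \val t by [].
have n2 : (n%:R : R) + n%:R = (n.*2)%:R by rewrite -natrD addnn.
exists (time_nat n), (flow phi (time_sub nt') x); split.
- by rewrite /= lexx ler_nat -addnn leq_addr.
- have [||s [y [sn cly ->]]] := IH (time_sub nt') _ _ x clx.
  + by rewrite /= lerBrDr n2 ltW.
  + by move: tm; rewrite /= lerBlDr -natrD -addnA -mulSnr.
  by apply: subset_closure; apply: interior_subset; exact: absU.
- rewrite -flow_add; congr flow; apply: val_inj.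
  by rewrite /= addrC subrK.
Qed.

(** By [attracting_nbhd_iterate] the omega-limit set lies in the set of points
    reached from the closure of U in a time between n and 2n. That set is
    compact, hence closed, and lies in the interior of U. *)
Lemma attracting_nbhd_of_absorb phi U n :
  hausdorff_space X -> compact [set: X] -> (0 < n)%N ->
  (forall t x, n%:R <= \val t <= (n.*2)%:R ->
    closure U x -> U° (flow phi t x)) ->
  attracting_nbhd phi U.
Proof.
move=> hX cX n0 absU.
pose W := (fun p => flow phi p.1 p.2) @`
  ([set t : time R k | n%:R <= \val t <= (n.*2)%:R] `*` closure U).
have clW : closed W.
  apply: closed_image_compact => //; first exact: flow_continuous.
  exact: compact_segment_closure.
move=> x /omegaP /(_ n%:R) clx.
have : W x.
  rewrite ((closure_id W).1 clW).
  apply: closureS clx => _z [t /= nt [y Uy <-]].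
  have [s [z [sn clz ->]]] :=
    attracting_nbhd_iterate n0 absU nt (subset_closure Uy).
  by exists (s, z).
by move=> [[t y] /= [tn cly] <-]; apply: absU.
Qed.

(** The criterion of [attracting_nbhd_of_absorb] constrains a flow on a
    compact set only, so it defines a subbasic open set of the compact-open
    topology. *)
Lemma attracting_nbhd_stable phi U :
  hausdorff_space X -> compact [set: X] -> attracting_nbhd phi U ->
  exists2 W : set (DS R k X), open W /\ W phi &
    forall psi, W psi -> attracting_nbhd psi U.
Proof.
move=> hX cX /(attracting_nbhd_absorb cX)[n n0 absU].
have cK := @compact_segment_closure n (n.*2) U cX.
set K := (X in compact X) in cK.
exists [set psi : DS R k X | \val psi @` K `<=` U°].
  split.
    by eexists; first exact: (compact_open_open cK (@open_interior _ U)).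
  by move=> _ [[t x] [/= /andP[nt _] clx] <-]; apply: absU.
move=> psi KU; apply: (@attracting_nbhd_of_absorb _ _ n) => // t x tn clx.
by apply: KU; exists (t, x).
Qed.

End flows.

(** * Changes of time *)

Section omega_equivariance.
Context (R : realType) (k : time_kind) (X Y : topologicalType).
Implicit Types (tau : time R k -> X -> time R k).

(** Pointwise this is the surjectivity of the change of time; monotonicity
    makes a bound at one time persist at later times, and continuity in the
    starting point together with compactness makes it uniform, as in Dini's
    theorem. *)
Lemma time_change_unbounded tau :
  compact [set: X] -> (forall t, continuous (tau t)) ->
  (forall x s t, \val s < \val t -> \val (tau s x) < \val (tau t x)) ->
  (forall x t, exists s, tau s x = t) ->
  forall r : R, exists r' : R, forall t x, r' <= \val t -> r <= \val (tau t x).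
Proof.
move=> /compact_near_coveringP cX ctau inc surj r.
have mono x s t : \val s <= \val t -> \val (tau s x) <= \val (tau t x).
  by rewrite le_eqVlt => /predU1P[/val_inj -> //|/(inc x)/ltW].
have [] : \forall r' \near +oo, [set: X] `<=`
    [set x | forall t, r' <= \val t -> r <= \val (tau t x)].
  apply: (cX R +oo (fun r' x => forall t, r' <= \val t -> r <= \val (tau t x))).
  move=> x _; have [n rn] := time_nat_ge (r + 1).
  have [s sn] := surj x (time_nat n).
  exists ([set y | r < \val (tau s y)], [set r' | \val s <= r']) => /=.
    split; last exact/nbhs_pinfty_ge/num_real.
    have cv : continuous (fun y => \val (tau s y)).
      move=> y; apply: continuous_comp; first exact: ctau.
      exact: initial_continuous.
    apply: (cv x [set u | r < u]); apply: open_nbhs_nbhs; split.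
      exact: open_gt.
    by rewrite /= sn /= (lt_le_trans _ rn) // ltrDl.
  move=> [y r'] /= [ry sr'] t r't.
  by apply/ltW/(lt_le_trans ry)/mono/(le_trans sr').
move=> M [_ Mr]; exists (M + 1) => t x Mt; apply: (Mr (M + 1)) => //.
by rewrite ltrDl.
Qed.

Lemma time_change_bounded tau :
  compact [set: X] -> (forall t, continuous (tau t)) ->
  forall t, exists r : R, forall x, \val (tau t x) <= r.
Proof.
move=> /compact_near_coveringP cX ctau t.
have [] : \forall r \near +oo, [set: X] `<=` [set x | \val (tau t x) <= r].
  apply: (cX R +oo (fun r x => \val (tau t x) <= r)) => x _.
  have cv : continuous (fun y => \val (tau t y)).
    move=> y; apply: continuous_comp; first exact: ctau.
      exact: initial_continuous.
  exists ([set y | \val (tau t y) < \val (tau t x) + 1],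
      [set r | \val (tau t x) + 1 <= r]) => /=.
    split; last exact/nbhs_pinfty_ge/num_real.
    apply: (cv x [set u | u < \val (tau t x) + 1]).
    apply: open_nbhs_nbhs; split.
      exact: open_lt.
    by rewrite /= ltrDl.
  by move=> [y r] /= [/ltW yx xr]; exact: le_trans xr.
move=> M [_ Mr]; exists (M + 1) => x; apply: (Mr (M + 1)) => //.
by rewrite ltrDl.
Qed.

(** The two previous lemmas compare the tails of U and of h(U): starting late
    in one system amounts to starting late in the other. *)
Lemma omega_image (phi : DS R k X) (psi : DS R k Y) (h : X -> Y) (g : Y -> X)
    tau :
  compact [set: X] -> continuous h -> continuous g ->
  cancel h g -> cancel g h -> (forall t, continuous (tau t)) ->
  (forall x s t, \val s < \val t -> \val (tau s x) < \val (tau t x)) ->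
  (forall x t, exists s, tau s x = t) ->
  (forall t x, h (flow phi t x) = flow psi (tau t x) (h x)) ->
  forall U, omega psi (h @` U) = h @` omega phi U.
Proof.
move=> cX ch cg hK gK ctau inc surj htau U.
have hcl r : h @` closure (tail phi U r) = closure (h @` tail phi U r).
  exact: (@image_closure _ _ _ g).
apply/seteqP; split=> [y /omegaP om|_ [x /omegaP om <-]].
  exists (g y); last exact: gK.
  apply/omegaP => r.
  suff : (h @` closure (tail phi U r)) y by case=> x clx <-; rewrite hK.
  rewrite hcl; have [n rn] := time_nat_ge r.
  have [M tauM] := time_change_bounded cX ctau (time_nat n).
  apply: closureS (om (M + 1)) => _y [s /= Ms [_ [x Ux <-] <-]].
  have [t ts] := surj x s; exists (flow phi t x); last by rewrite htau ts.
  exists t; last by exists x.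
  apply: (le_trans rn); rewrite leNgt; apply/negP => /(inc x _ (time_nat n)).
  rewrite ts => /lt_le_trans/(_ (tauM x)) sM.
  have : M + 1 < M := le_lt_trans Ms sM.
  by rewrite ltNge lerDl ler01.
apply/omegaP => r.
have [r' taur'] := time_change_unbounded cX ctau inc surj r.
have : (h @` closure (tail phi U r')) (h x) by exists x.
rewrite hcl; apply: closureS => _y [_ [s /= rs [z Uz <-]] <-].
by rewrite htau; exists (tau s z); [exact: taur'|exists (h z) => //; exists z].
Qed.

End omega_equivariance.

(** * The topology of the space of attractors and of its pullbacks *)

Section etale_topology.
Context (R : realType) (k : time_kind) (X : topologicalType).

Lemma open_etale_basic (U : set X) (W : set (DS R k X)) :
  open W -> (forall phi, W phi -> attracting_nbhd phi U) ->
  open (etale_basic (U, W)).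
Proof.
move=> oW WU; exists [set etale_basic (U, W)]; last by rewrite bigcup_set1.
move=> _ ->; exists [fset (U, W)]%fset; last by rewrite set_fset1 bigcap_set1.
by move=> i; rewrite !inE => /eqP ->.
Qed.

(** Convergence may be tested on the subbase that generates the topology. *)
Lemma etale_cvg (F : set_system (etale_att R k X)) (e : etale_att R k X) :
  Filter F ->
  (forall U W, open W -> (forall phi, W phi -> attracting_nbhd phi U) ->
     W (etale_sys e) -> etale_set e = omega (etale_sys e) U ->
     F (etale_basic (U, W))) ->
  F --> e.
Proof.
move=> FF FB C; rewrite nbhsE => -[_ [[D sD <-] [B DB Be]] DC].
have [K sK BE] := sD _ DB; apply: filterS DC _.
apply: (@filterS _ F _ B) => [x Bx|]; first by exists B.
rewrite -BE in Be *; apply: filter_bigI => -[U W] KUW.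
have := sK _ KUW; rewrite inE => -[/= oW WU].
by have [/= We eE] := Be _ KUW; exact: FB.
Qed.

Lemma etale_att_eq (e e' : etale_att R k X) :
  etale_sys e = etale_sys e' -> etale_set e = etale_set e' -> e = e'.
Proof.
case: e e' => [phi A P] [psi B Q] /= pq AB; case: _ / pq Q => Q.
by case: _ / AB Q => Q; rewrite (Prop_irrelevance P Q).
Qed.

End etale_topology.

Section pullback.
Context (R : realType) (k : time_kind) (L X : topologicalType).
Implicit Type phi : param_dynsys R k L X.

(** For each compact set of pairs (time, point), the tube lemma applied to the
    parametrized flow is the continuity condition of the compact-open
    topology. *)
Lemma pds_star_continuous phi : continuous (pds_star phi).
Proof.
apply: (@continuous_comp_initial _ L _ _ (pds_star phi)) => l.
apply/compact_open_cvgP => K W cK oW KW.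
have cphi : continuous (fun p : L * (time R k * X) => pds_fun phi (p.2, p.1)).
  move=> p; apply: (@continuous_comp _ _ _ (fun p => (p.2, p.1))).
    by apply: continuous_pair => q; [exact: cvg_snd|exact: cvg_fst].
  exact: pds_continuous.
have KW' x : K x -> W (pds_fun phi (x, l)) by move=> Kx; apply: KW; exists x.
have := near_image_sub cphi cK oW KW'.
by apply: filterS => l' Kl' _ [x Kx <-]; exact: Kl'.
Qed.

Lemma param_flow_continuous phi t :
  continuous (fun p : L * X => flow (pds_star phi p.1) t p.2).
Proof.
move=> p; apply: (@continuous_comp _ _ _ (fun p => (t, p.2, p.1))
  (pds_fun phi)).
  apply: continuous_pair => [q|q]; last exact: cvg_fst.
  by apply: continuous_pair => [|r]; [exact: cst_continuous|exact: cvg_snd].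
exact: pds_continuous.
Qed.

Definition pullback_base phi (p : etale_pullback phi) : L := (\val p).1.

Definition pullback_point phi (p : etale_pullback phi) : etale_att R k X :=
  (\val p).2.

Lemma pullback_base_continuous phi : continuous (@pullback_base phi).
Proof.
move=> p; apply: continuous_comp; last exact: cvg_fst.
exact: initial_continuous.
Qed.

Lemma pullback_point_continuous phi : continuous (@pullback_point phi).
Proof.
move=> p; apply: continuous_comp; last exact: cvg_snd.
exact: initial_continuous.
Qed.

Lemma etale_sys_pullback phi (p : etale_pullback phi) :
  etale_sys (pullback_point p) = pds_star phi (pullback_base p).
Proof. exact: (set_valP p). Qed.

Lemma etale_pullback_eq phi (p q : etale_pullback phi) :
  pullback_base p = pullback_base q ->
  etale_set (pullback_point p) = etale_set (pullback_point q) -> p = q.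
Proof.
move=> pq1 pq2; apply: val_inj.
rewrite [\val p]surjective_pairing [\val q]surjective_pairing.
rewrite -!/(pullback_base _) -!/(pullback_point _) pq1; congr pair.
by apply: etale_att_eq => //; rewrite !etale_sys_pullback pq1.
Qed.

End pullback.

(** * Transfer of attractors along a family of homeomorphisms *)

Section transfer.
Context (R : realType) (k : time_kind) (L : topologicalType).

(** What a conjugacy leaves once time has been forgotten.  Unlike the notion
    of conjugacy itself, this one is visibly symmetric: exchanging the two
    systems does not require inverting the change of time jointly
    continuously. *)
Record omega_equivalence (X Y : topologicalType) (phi : param_dynsys R k L X)
    (psi : param_dynsys R k L Y) (h : L * X -> Y) (g : L * Y -> X) : Prop := {
  oe_h : continuous h;
  oe_g : continuous g;
  oe_hK : forall l, cancel (fun x => h (l, x)) (fun y => g (l, y));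
  oe_gK : forall l, cancel (fun y => g (l, y)) (fun x => h (l, x));
  oe_omega : forall l U, omega (pds_star psi l) ((fun x => h (l, x)) @` U) =
    (fun x => h (l, x)) @` omega (pds_star phi l) U }.

Lemma omega_equivalence_sym (X Y : topologicalType) (phi : param_dynsys R k L X)
    (psi : param_dynsys R k L Y) (h : L * X -> Y) (g : L * Y -> X) :
  omega_equivalence phi psi h g -> omega_equivalence psi phi g h.
Proof.
case=> ch cg hK gK om; split=> // l V.
have := om l ((fun y => g (l, y)) @` V).
by rewrite (image_cancel _ (gK l)) => ->; rewrite (image_cancel _ (hK l)).
Qed.

Section attractors.
Context (X Y : topologicalType) (phi : param_dynsys R k L X)
    (psi : param_dynsys R k L Y) (h : L * X -> Y) (g : L * Y -> X).
Context (hg : omega_equivalence phi psi h g).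

Lemma omega_equivalence_attracting l U :
  attracting_nbhd (pds_star phi l) U ->
  attracting_nbhd (pds_star psi l) ((fun x => h (l, x)) @` U).
Proof.
case: hg => ch cg hK gK om; rewrite /attracting_nbhd om => aU.
apply: subset_trans (image_interior (g := fun y => g (l, y)) _ _ _) => //.
  exact: image_subset.
exact: continuous_fiber.
Qed.

Lemma omega_equivalence_attractor l A :
  attractor (pds_star phi l) A ->
  attractor (pds_star psi l) ((fun x => h (l, x)) @` A).
Proof.
move=> [U aU ->]; exists ((fun x => h (l, x)) @` U).
  exact: omega_equivalence_attracting.
by rewrite (oe_omega hg).
Qed.

(** At l = l0 the set on the left is V itself and V absorbs its closure after
    a fixed time t. For l near l0, the time-t map still sends the set on the
    left into V and V into the set on the left. *)
Lemma omega_transport_near l0 V :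
  compact [set: X] -> compact [set: Y] ->
  attracting_nbhd (pds_star psi l0) V ->
  \forall l \near l0,
    omega (pds_star psi l)
      ((fun x => h (l, x)) @` ((fun y => g (l0, y)) @` V)) =
    omega (pds_star psi l) V.
Proof.
move=> cX cY /(attracting_nbhd_absorb cY)[n _ absV].
have [ch cg hK gK _] := hg.
pose t := time_nat n : time R k; pose U := (fun y => g (l0, y)) @` V.
have {}absV y : closure V y -> V° (flow (pds_star psi l0) t y).
  by apply: absV; exact: lexx.
have near1 : \forall l \near l0, forall x, closure U x ->
    V° (flow (pds_star psi l) t (h (l, x))).
  apply: (near_image_sub (f := fun p => flow (pds_star psi p.1) t (h p))).
  - move=> r; apply: (@continuous_comp _ _ _ (fun r => (r.1, h r))
      (fun p => flow (pds_star psi p.1) t p.2)).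
      by apply: continuous_pair => // r'; exact: cvg_fst.
    exact: param_flow_continuous.
  - exact: compact_closure.
  - exact: open_interior.
  - move=> x Ux; apply: absV; rewrite -(image_cancel V (gK l0)).
    by apply: image_closure_sub; [exact: continuous_fiber|exists x].
have near2 : \forall l \near l0, forall y, closure V y ->
    U° (g (l, flow (pds_star psi l) t y)).
  apply: (near_image_sub
    (f := fun p => g (p.1, flow (pds_star psi p.1) t p.2))).
  - move=> r; apply: (@continuous_comp _ _ _
      (fun p => (p.1, flow (pds_star psi p.1) t p.2)) g); last exact: cg.
    apply: continuous_pair => [r'|]; first exact: cvg_fst.
    exact: param_flow_continuous.
  - exact: compact_closure.
  - exact: open_interior.
  - move=> y Vy.
    apply: (image_interior (continuous_fiber ch) (gK l0) (hK l0)).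
    by exists (flow (pds_star psi l0) t y) => //; exact: absV.
apply: filterS (filterI near1 near2) => l [Ul Vl]; apply/seteqP; split.
  apply: (@omega_sub_absorb _ _ _ _ _ _ t) => _ [_ [x Ux <-] <-].
  by apply: interior_subset; apply: Ul; exact: subset_closure.
apply: (@omega_sub_absorb _ _ _ _ _ _ t) => _ [y Vy <-].
exists (g (l, flow (pds_star psi l) t y)); last exact: gK.
by apply: interior_subset; apply: Vl; exact: subset_closure.
Qed.

End attractors.

Section etale_transfer.
Context (X Y : topologicalType) (phi : param_dynsys R k L X)
    (psi : param_dynsys R k L Y) (h : L * X -> Y) (g : L * Y -> X).
Context (hg : omega_equivalence phi psi h g).

Lemma pullback_attractor (p : etale_pullback phi) :
  attractor (pds_star phi (pullback_base p)) (etale_set (pullback_point p)).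
Proof. by rewrite -etale_sys_pullback; exact: etale_attP. Qed.

Definition etale_transfer (p : etale_pullback phi) : etale_pullback psi :=
  let l := pullback_base p in
  let e := EtaleAtt (omega_equivalence_attractor hg (pullback_attractor p)) in
  SigSub (mem_set (erefl : [set p : L * etale_att R k Y |
    etale_sys p.2 = pds_star psi p.1] (l, e))).

Lemma etale_transfer_continuous :
  compact [set: X] -> hausdorff_space X ->
  compact [set: Y] -> continuous etale_transfer.
Proof.
move=> cX hX cY.
apply: (@continuous_comp_initial _ (etale_pullback phi) _ _ etale_transfer).
apply: continuous_pair => p; first exact: pullback_base_continuous.
apply: etale_cvg; first exact: (@fmap_filter _ _ _ (nbhs p)).
move=> V W oW WV /=.
set l0 := pullback_base p; set A0 := etale_set (pullback_point p) => Wl0 AV.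
have gh := omega_equivalence_sym hg.
pose U := (fun y => g (l0, y)) @` V.
(* The attractor over p is the omega-limit set of the pulled back
   neighborhood, so U and a stability set W' give a basic neighborhood of p. *)
have A0U : A0 = omega (pds_star phi l0) U.
  by rewrite (oe_omega gh) -AV (image_cancel _ (oe_hK hg l0)).
have aU : attracting_nbhd (pds_star phi l0) U.
  exact: (omega_equivalence_attracting gh (WV _ Wl0)).
have sysp : etale_sys (pullback_point p) = pds_star phi l0.
  exact: etale_sys_pullback.
have [W' [oW' W'l0] W'U] := attracting_nbhd_stable hX cX aU.
have near1 : \forall q \near p, etale_basic (U, W') (pullback_point q).
  apply: pullback_point_continuous; apply: open_nbhs_nbhs.
  by split; [exact: open_etale_basic|split; rewrite /= sysp].
have near2 : \forall q \near p, W (pds_star psi (pullback_base q)).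
  apply: (@pullback_base_continuous _ _ _ _ phi p
    (fun l => W (pds_star psi l))).
  by apply: pds_star_continuous; exact: open_nbhs_nbhs.
have near3 := @pullback_base_continuous _ _ _ _ phi p _
  (omega_transport_near hg cX cY (WV _ Wl0)).
apply: filterS (filterI near1 (filterI near2 near3)).
move=> q [[/= _ qU] [Wq qV]]; split=> //.
by rewrite /= qU etale_sys_pullback -(oe_omega hg).
Qed.

End etale_transfer.

End transfer.

(** * Conjugate systems *)

Theorem theorem8p7 (R : realType) (k : time_kind) (X Y : metricType R)
    (L : topologicalType) (phi : param_dynsys R k L X)
    (psi : param_dynsys R k L Y) :
  compact [set: X] -> compact [set: Y] ->
  conjugate phi psi ->
  homeomorphic (etale_pullback phi) (etale_pullback psi).
Proof.
move=> cX cY [h [tau [ch ctau conj _]]].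
have gex l : exists gl : Y -> X, [/\ continuous gl,
    cancel (fun x => h (l, x)) gl & cancel gl (fun x => h (l, x))].
  by have [[_ hg] _ _ _ _] := conj l.
have [g0 g0P] := choice gex.
pose g (p : L * Y) := g0 p.1 p.2.
have hK l : cancel (fun x => h (l, x)) (fun y => g (l, y)).
  by have [_ hgK _] := g0P l.
have gK l : cancel (fun y => g (l, y)) (fun x => h (l, x)).
  by have [_ _ ghK] := g0P l.
have cg : continuous g.
  apply: (fiberwise_inverse_continuous cX _ ch hK gK).
  exact: metric_hausdorff.
have hg : omega_equivalence phi psi h g.
  split=> // l U; have [_ tau0 inc bij htau] := conj l.
  apply: (@omega_image _ _ _ _ _ _ _ (fun y => g (l, y))
    (fun t x => tau (l, t, x))) => //.
  - exact: continuous_fiber.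
  - exact: continuous_fiber.
  - move=> t x; apply: (@continuous_comp _ _ _ (fun x => (l, t, x)) tau).
      by apply: continuous_pair; [exact: cst_continuous|exact: continuous_id].
    exact: ctau.
  - by move=> x t; have [s _ sK] := bij x; exists (s t); exact: sK.
have gh := omega_equivalence_sym hg.
exists (etale_transfer hg); split.
  by apply: etale_transfer_continuous => //; exact: metric_hausdorff.
exists (etale_transfer gh); split.
- by apply: etale_transfer_continuous => //; exact: metric_hausdorff.
- by move=> p; apply: etale_pullback_eq => //=; exact: image_cancel.
- by move=> p; apply: etale_pullback_eq => //=; exact: image_cancel.
Qed.
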